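(* Let $n\in\{6,7,8\}$ and $N_1,\dots,N_n\geq 0$ be integers. Let $Q$ be the quiver with vertices $1,\dots,n$, arrows $x_3:1\to 3$, $x_4:3\to 4$, $x_2:4\to 2$, $x_i:i-1\to i$ for $5\le i\le n$, and $N_i$ loops at vertex $i$ for each $i$. Let $E(n)=\Bbbk Q/(\geq 2)$. Then $$\operatorname{fpd}\big(E(n)\text{-mod}\big)=\max\{N_1,\dots,N_n\}.$$
   Context: $\Bbbk$ is an algebraically closed field; $\Bbbk Q$ is the path algebra with $e_i\alpha=\delta_{i,t(\alpha)}\alpha$, $\alpha e_j=\delta_{j,s(\alpha)}\alpha$; $(\geq 2)$ is the ideal generated by paths of length $\geq 2$; $A\text{-mod}$ is the category of finite-dimensional left $A$-modules. For a $\Bbbk$-linear abelian category $\mathcal C$: an object $M$ is a brick if $\mathrm{Hom}(M,M)=\Bbbk$; a finite set $\phi=\{X_1,\dots,X_m\}$ of nonzero objects is a brick set if each $X_i$ is a brick and $\dim\mathrm{Hom}(X_i,X_j)=\delta_{ij}$; its adjacency matrix is $A(\phi)=(\dim\mathrm{Ext}^1_{\mathcal C}(X_i,X_j))_{i,j}$; and $\operatorname{fpd}(\mathcal C)=\sup_{\phi}\rho(A(\phi))$, the supremum over all brick sets of the spectral radius $\rho$. *)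

(* Defs.v *)
From HB Require Import structures.
From mathcomp Require Import all_boot all_order all_algebra all_field.
Set Implicit Arguments. Unset Strict Implicit. Unset Printing Implicit Defensive.
Import Order.TTheory GRing.Theory Num.Theory.
Local Open Scope ring_scope.

(* Quivers.  Vertices are labelled 1..qv; the vertex [i : 'I_qv] has   *)
(* label [i.+1].  Arrows are a list of (source label, target label).  *)
Record quiver := Quiver { qv : nat; qarr : seq (nat * nat) }.

Definition qna (Q : quiver) := size (qarr Q).
Definition qsrc (Q : quiver) (a : 'I_(qna Q)) : nat := (nth (0%N, 0%N) (qarr Q) a).1.
Definition qtgt (Q : quiver) (a : 'I_(qna Q)) : nat := (nth (0%N, 0%N) (qarr Q) a).2.

(* Finite-dimensional left modules over E = kQ/(>= 2), via the         *)
(* standard presentation of kQ by the idempotents e_i and the arrows,  *)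
(* plus the relations (paths of length 2) = 0.  A module of dimension  *)
(* d is given (after choosing a basis) by matrices acting on column    *)
(* vectors K^d, respecting products: rho(uv) = rho(u) *m rho(v).        *)
Definition is_Emod (K : fieldType) (Q : quiver) (d : nat)
    (e : 'I_(qv Q) -> 'M[K]_d) (x : 'I_(qna Q) -> 'M[K]_d) : Prop :=
  [/\ (forall i j : 'I_(qv Q), e i *m e j = if i == j then e i else 0),
      \sum_(i < qv Q) e i = 1%:M,
      (forall (i : 'I_(qv Q)) (a : 'I_(qna Q)),
          e i *m x a = if i.+1 == qtgt a then x a else 0),
      (forall (a : 'I_(qna Q)) (j : 'I_(qv Q)),
          x a *m e j = if j.+1 == qsrc a then x a else 0)
    & (forall a b : 'I_(qna Q), x a *m x b = 0)].

Record Emod (K : fieldType) (Q : quiver) := EMod {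
  mdim : nat;
  mvert : 'I_(qv Q) -> 'M[K]_mdim;
  marr : 'I_(qna Q) -> 'M[K]_mdim;
  maxioms : is_Emod mvert marr }.

Section HomExt.
Variables (K : fieldType) (Q : quiver).
Implicit Types X Y : Emod K Q.

Definition hom_space X Y : 'M[K]_(mdim Y * mdim X) :=
  ((\bigcap_(i < qv Q) kermx (lin_mx (fun f : 'M[K]_(mdim Y, mdim X) =>
        f *m mvert X i - mvert Y i *m f)))
   :&: (\bigcap_(a < qna Q) kermx (lin_mx (fun f : 'M[K]_(mdim Y, mdim X) =>
        f *m marr X a - marr Y a *m f))))%MS.

Definition dim_hom X Y : nat := \rank (hom_space X Y).

(* Ext^1(X,Y) = Der(E, Hom_k(X,Y)) / Inn.  A derivation is given by its  *)
(* values delta(g) : K^{dX} -> K^{dY} on the generators g (vertices      *)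
(* first, then arrows), stored as the rows (mxvec) of a matrix.          *)
(* delta is a cocycle iff the block matrices [[rhoY g, delta g],[0, rhoX g]] *)
(* on Y (+) X satisfy the defining relations of E, i.e. iff the upper    *)
(* right blocks of all relation residuals vanish.                        *)
Definition ngen := (qv Q + qna Q)%N.
Definition gv (i : 'I_(qv Q)) : 'I_ngen := lshift (qna Q) i.
Definition ga (a : 'I_(qna Q)) : 'I_ngen := rshift (qv Q) a.

Definition rgen X (g : 'I_ngen) : 'M[K]_(mdim X) :=
  match split g with inl i => mvert X i | inr a => marr X a end.

Definition dgen X Y (D : 'M[K]_(ngen, mdim Y * mdim X)) (g : 'I_ngen)
  : 'M[K]_(mdim Y, mdim X) := vec_mx (row g D).

Definition ZB X Y (D : 'M[K]_(ngen, mdim Y * mdim X)) (g : 'I_ngen)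
  : 'M[K]_(mdim Y + mdim X) := block_mx (rgen Y g) (dgen D g) 0 (rgen X g).

Definition cocycle_space X Y : 'M[K]_(ngen * (mdim Y * mdim X)) :=
  let T := 'M[K]_(ngen, mdim Y * mdim X) in
  ((\bigcap_(i < qv Q) \bigcap_(j < qv Q) kermx (lin_mx (fun D : T =>
        ursubmx (ZB D (gv i) *m ZB D (gv j) - (if i == j then ZB D (gv i) else 0)))))
   :&: kermx (lin_mx (fun D : T =>
        ursubmx (\sum_(i < qv Q) ZB D (gv i) - 1%:M)))
   :&: (\bigcap_(i < qv Q) \bigcap_(a < qna Q) kermx (lin_mx (fun D : T =>
        ursubmx (ZB D (gv i) *m ZB D (ga a)
                 - (if i.+1 == qtgt a then ZB D (ga a) else 0)))))
   :&: (\bigcap_(a < qna Q) \bigcap_(j < qv Q) kermx (lin_mx (fun D : T =>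
        ursubmx (ZB D (ga a) *m ZB D (gv j)
                 - (if j.+1 == qsrc a then ZB D (ga a) else 0)))))
   :&: (\bigcap_(a < qna Q) \bigcap_(b < qna Q) kermx (lin_mx (fun D : T =>
        ursubmx (ZB D (ga a) *m ZB D (ga b))))))%MS.

Definition coboundary X Y (f : 'M[K]_(mdim Y, mdim X)) : 'M[K]_(ngen, mdim Y * mdim X) :=
  \matrix_(g < ngen) mxvec (rgen Y g *m f - f *m rgen X g).

Definition dim_ext X Y : nat :=
  (\rank (cocycle_space X Y) - \rank (lin_mx (@coboundary X Y)))%N.

Definition brick_set (m : nat) (B : 'I_m -> Emod K Q) : Prop :=
  (forall i, 0 < mdim (B i))%N /\
  (forall i j, dim_hom (B i) (B j) = (i == j) :> nat).

Definition adjacency (m : nat) (B : 'I_m -> Emod K Q) : 'M[algC]_m :=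
  \matrix_(i, j) (dim_ext (B i) (B j))%:R.

End HomExt.

Definition spectral_radius (m : nat) (A : 'M[algC]_m) : algC :=
  \big[Num.max/0]_(z <- sval (closed_field_poly_normal (char_poly A))) `|z|.

Definition fpd_is (K : fieldType) (Q : quiver) (s : algC) : Prop :=
  (forall m (B : 'I_m -> Emod K Q), brick_set B -> spectral_radius (adjacency B) <= s) /\
  (forall eps : algC, 0 < eps -> exists m (B : 'I_m -> Emod K Q),
       brick_set B /\ s - eps < spectral_radius (adjacency B)).

Definition En_quiver (n : nat) (N : 'I_n -> nat) : quiver :=
  Quiver n ([:: (1, 3); (3, 4); (4, 2)]%N
            ++ [seq (i.-1, i) | i <- iota 5 (n - 4)]
            ++ flatten [seq nseq (N i) (i.+1, i.+1) | i <- enum 'I_n]).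

(* Main.v *)
Require Import Defs.
From HB Require Import structures.
From mathcomp Require Import all_boot all_order all_algebra all_field.
From mathcomp Require Import zify.
Import Order.TTheory GRing.Theory Num.Theory.
Local Open Scope ring_scope.
Set Implicit Arguments. Unset Strict Implicit. Unset Printing Implicit Defensive.

(* If a: i -> j and b: k -> i are arrows acting nontrivially on modules X and Y, some map
   X -> X/rad X -> S_i -> soc Y -> Y is nonzero.  Applied to X = Y a brick, this shows that
   loops act by zero and that each vertex carries only top or only socle.  As every vertex
   has at most one parent and at most two children in the tree of non-loop arrows, a
   non-simple brick is generated by a component at one vertex i, of which the components at
   some children of i are copies; such a brick has no self-extension, while
   dim Ext^1(S_i, S_i) = N_i.
   Between two distinct members X and Y of a brick set, Ext^1(X, Y) can be nonzero only if
   the top vertex of Y lies strictly deeper in the tree than the top vertex of X.  So the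
   adjacency matrix is triangular up to a permutation, with diagonal entries 0 or N_i.  The
   bound is attained by the brick set {S_i} with N_i maximal. *)

(** * Hom spaces and cocycles in coordinates *)

Section LinearAlgebra.
Variable K : fieldType.

(** The Hom and cocycle spaces feed bare functions to [lin_mx], so linearity comes as a hypothesis
    and is bundled here. *)
Lemma mul_vec_lin_of_linear m1 n1 m2 n2 (f : 'M[K]_(m1, n1) -> 'M[K]_(m2, n2)) :
  linear f -> forall A, mxvec A *m lin_mx f = mxvec (f A).
Proof.
move=> f_lin A.
pose fL : {linear _ -> _} := HB.pack f (GRing.isLinear.Build _ _ _ _ f f_lin).
exact: (mul_vec_lin fL).
Qed.

Lemma sub_kermx_lin_mx m1 n1 m2 n2 (f : 'M[K]_(m1, n1) -> 'M[K]_(m2, n2)) A :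
  linear f -> reflect (f A = 0) (mxvec A <= kermx (lin_mx f))%MS.
Proof.
move=> f_lin; apply: (iffP sub_kermxP); rewrite mul_vec_lin_of_linear //.
  by move/(canRL mxvecK); rewrite raddf0.
by move->; rewrite raddf0.
Qed.

(** A matrix unit for [M] multiplies a row of [B] by a nonzero entry of [A]. Used throughout as: if
    every composite through a free middle map vanishes, so does a factor. *)
Lemma mulmx_delta_eq0 m n p q (A : 'M[K]_(m, n)) (B : 'M[K]_(p, q)) :
  (forall M : 'M_(n, p), A *m M *m B = 0) -> A != 0 -> B = 0.
Proof.
move=> AMB0 /matrix0Pn [i [j Aij]]; apply/matrixP => k l.
have /matrixP/(_ i l) := AMB0 (delta_mx j k).
rewrite -(mul_delta_mx (0 : 'I_1)) mulmxA -mulmxA -colE -rowE !mxE big_ord1 !mxE.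
by move/eqP; rewrite mulf_eq0 (negPf Aij) => /eqP.
Qed.

Lemma generalized_inverse m n (A : 'M[K]_(m, n)) : exists G, A *m G *m A = A.
Proof. by exists (pinvmx A); rewrite mulmxKpV. Qed.

Lemma ursubmx0 m1 m2 n1 n2 : ursubmx (0 : 'M[K]_(m1 + m2, n1 + n2)) = 0.
Proof. by rewrite /ursubmx !raddf0. Qed.

Lemma ursubmxB m1 m2 n1 n2 (A B : 'M[K]_(m1 + m2, n1 + n2)) :
  ursubmx (A - B) = ursubmx A - ursubmx B.
Proof. by rewrite /ursubmx !raddfB. Qed.

Lemma ursubmx_sum m1 m2 n1 n2 I (r : seq I) (F : I -> 'M[K]_(m1 + m2, n1 + n2)) :
  ursubmx (\sum_(i <- r) F i) = \sum_(i <- r) ursubmx (F i).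
Proof. by rewrite /ursubmx !raddf_sum. Qed.

End LinearAlgebra.

Section HomExtSpaces.
Variables (K : fieldType) (Q : quiver).
Implicit Types X Y : Emod K Q.

Definition is_hom X Y (f : 'M[K]_(mdim Y, mdim X)) : Prop :=
  (forall i, mvert Y i *m f = f *m mvert X i) /\
  (forall a, marr Y a *m f = f *m marr X a).

Lemma hom_spaceP X Y (f : 'M[K]_(mdim Y, mdim X)) :
  reflect (is_hom f) (mxvec f <= hom_space X Y)%MS.
Proof.
rewrite sub_capmx; apply: (iffP andP).
  case=> /sub_bigcapmxP fe /sub_bigcapmxP fx; split=> [i | a].
    move: (fe i isT) => /sub_kermx_lin_mx H; apply/esym/eqP; rewrite -subr_eq0; apply/eqP/H.
    by move=> c u v; rewrite mulmxDl mulmxDr -scalemxAl -scalemxAr opprD scalerBr addrACA.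
  move: (fx a isT) => /sub_kermx_lin_mx H; apply/esym/eqP; rewrite -subr_eq0; apply/eqP/H.
  by move=> c u v; rewrite mulmxDl mulmxDr -scalemxAl -scalemxAr opprD scalerBr addrACA.
case=> fe fx; split; apply/sub_bigcapmxP=> i _; apply/sub_kermx_lin_mx; rewrite ?fe ?fx ?subrr //.
  by move=> c u v; rewrite mulmxDl mulmxDr -scalemxAl -scalemxAr opprD scalerBr addrACA.
by move=> c u v; rewrite mulmxDl mulmxDr -scalemxAl -scalemxAr opprD scalerBr addrACA.
Qed.

Lemma is_hom_id X : is_hom (1%:M : 'M_(mdim X)).
Proof. by split=> *; rewrite mulmx1 mul1mx. Qed.

Lemma hom_eq0 X Y f : dim_hom X Y = 0%N -> is_hom f -> f = 0 :> 'M_(mdim Y, mdim X).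
Proof.
move=> /eqP; rewrite /dim_hom mxrank_eq0 => /eqP h0 /hom_spaceP; rewrite h0 submx0 => /eqP.
by move/(canRL mxvecK); rewrite raddf0.
Qed.

(** The identity is a nonzero vector of a one-dimensional Hom space, hence spans it. *)
Lemma endo_scalar X f : (0 < mdim X)%N -> dim_hom X X = 1%N -> is_hom f ->
  exists c, f = c%:M :> 'M_(mdim X).
Proof.
move=> X_gt0 h1 /hom_spaceP fX; have /hom_spaceP idX := is_hom_id X.
have id_neq0 : mxvec (1%:M : 'M[K]_(mdim X)) != 0.
  apply/negP => /eqP/(canRL mxvecK); rewrite raddf0 => /eqP.
  by rewrite -mxrank_eq0 mxrank1 gtn_eqF.
have := mxrank_leqif_sup idX; rewrite rank_rV id_neq0 => [[_ /esym]].
rewrite -[\rank _]/(dim_hom X X) h1 eqxx => /(submx_trans fX)/sub_rVP[c fE].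
by exists c; rewrite -(mxvecK f) fE linearZ /= mxvecK scale_scalar_mx mulr1.
Qed.

(** The Leibniz rule on each defining relation, read off the upper right blocks; the identity matrix
    contributes zero there. *)
Definition is_cocycle X Y (D : 'M[K]_(ngen Q, mdim Y * mdim X)) : Prop :=
  let d g := dgen D g in
  [/\ (forall i j, mvert Y i *m d (gv j) + d (gv i) *m mvert X j =
         if i == j then d (gv i) else 0),
      \sum_i d (gv i) = 0,
      (forall i a, mvert Y i *m d (ga a) + d (gv i) *m marr X a =
         if i.+1 == qtgt a then d (ga a) else 0),
      (forall a j, marr Y a *m d (gv j) + d (ga a) *m mvert X j =
         if j.+1 == qsrc a then d (ga a) else 0)
    & (forall a b, marr Y a *m d (ga b) + d (ga a) *m marr X b = 0)].

Lemma rgenv X i : rgen X (gv i) = mvert X i.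
Proof. by rewrite /rgen (unsplitK (inl i)). Qed.
Lemma rgena X a : rgen X (ga a) = marr X a.
Proof. by rewrite /rgen (unsplitK (inr a)). Qed.

Lemma ursubmx_ZBM X Y (D : 'M[K]_(ngen Q, mdim Y * mdim X)) g h :
  ursubmx (ZB D g *m ZB D h) = rgen Y g *m dgen D h + dgen D g *m rgen X h.
Proof. by rewrite mulmx_block block_mxKur. Qed.

Lemma ursubmx_ZB X Y (D : 'M[K]_(ngen Q, mdim Y * mdim X)) g :
  ursubmx (ZB D g) = dgen D g.
Proof. by rewrite block_mxKur. Qed.

Lemma dgen_linear X Y g : linear (fun D : 'M[K]_(ngen Q, mdim Y * mdim X) => dgen D g).
Proof. by move=> c u v; rewrite /dgen linearP /= linearP. Qed.

Lemma cocycle_spaceP X Y (D : 'M[K]_(ngen Q, mdim Y * mdim X)) :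
  reflect (is_cocycle D) (mxvec D <= cocycle_space X Y)%MS.
Proof.
have linM g h : linear (fun D : 'M[K]_(ngen Q, mdim Y * mdim X) => ursubmx (ZB D g *m ZB D h)).
  move=> c u v; rewrite !ursubmx_ZBM !dgen_linear mulmxDl mulmxDr -scalemxAl -scalemxAr.
  by rewrite scalerDr addrACA.
(* The Boolean covers the three conditional families of relations at once. *)
have linB g h (b : bool) k :
    linear (fun D : 'M[K]_(ngen Q, mdim Y * mdim X) =>
              ursubmx (ZB D g *m ZB D h - (if b then ZB D k else 0))).
  move=> c u v; rewrite !ursubmxB linM.
  by case: b; rewrite ?ursubmx0 ?subr0 // !ursubmx_ZB dgen_linear scalerBr opprD addrACA.
have linS : linear (fun D : 'M[K]_(ngen Q, mdim Y * mdim X) =>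
                      ursubmx (\sum_(i < qv Q) ZB D (gv i) - 1%:M)).
  move=> c u v; rewrite !ursubmxB !ursubmx_sum !scalar_mx_block !block_mxKur !subr0.
  rewrite scaler_sumr -big_split; apply: eq_bigr => i _ /=.
  by rewrite !ursubmx_ZB dgen_linear.
have eqB (A B : 'M[K]_(mdim Y, mdim X)) : A - B = 0 <-> A = B.
  by split=> [/eqP | ->]; [rewrite subr_eq0 => /eqP | rewrite subrr].
have valB g h (b : bool) k :
   ursubmx (ZB D g *m ZB D h - (if b then ZB D k else 0)) = 0 <->
   rgen Y g *m dgen D h + dgen D g *m rgen X h = if b then dgen D k else 0.
  by rewrite ursubmxB ursubmx_ZBM (fun_if (@ursubmx _ _ _ _ _)) ursubmx_ZB ursubmx0.
have valS : ursubmx (\sum_(i < qv Q) ZB D (gv i) - 1%:M) = 0 <-> \sum_i dgen D (gv i) = 0.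
  rewrite ursubmxB ursubmx_sum scalar_mx_block block_mxKur subr0.
  by under eq_bigr => i _ do rewrite ursubmx_ZB.
rewrite /cocycle_space !sub_capmx; apply: (iffP idP).
  rewrite -!andbA => /and5P[/sub_bigcapmxP H1 /sub_kermx_lin_mx H2 /sub_bigcapmxP H3
    /sub_bigcapmxP H4 /sub_bigcapmxP H5]; split.
  - move=> i j; have /sub_bigcapmxP/(_ j isT)/sub_kermx_lin_mx/valB := H1 i isT.
    by rewrite !rgenv; apply.
  - by apply/valS/H2.
  - move=> i j; have /sub_bigcapmxP/(_ j isT)/sub_kermx_lin_mx/valB := H3 i isT.
    by rewrite !rgenv !rgena; apply.
  - move=> i j; have /sub_bigcapmxP/(_ j isT)/sub_kermx_lin_mx/valB := H4 i isT.
    by rewrite !rgenv !rgena; apply.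
  - move=> i j; have /sub_bigcapmxP/(_ j isT)/sub_kermx_lin_mx := H5 i isT.
    by rewrite ursubmx_ZBM !rgena; apply.
case=> H1 H2 H3 H4 H5; rewrite -!andbA; apply/and5P; split.
- apply/sub_bigcapmxP=> i _; apply/sub_bigcapmxP=> j _; apply/sub_kermx_lin_mx => //.
  by apply/valB; rewrite !rgenv.
- by apply/sub_kermx_lin_mx => //; apply/valS.
- apply/sub_bigcapmxP=> i _; apply/sub_bigcapmxP=> j _; apply/sub_kermx_lin_mx => //.
  by apply/valB; rewrite !rgenv !rgena.
- apply/sub_bigcapmxP=> i _; apply/sub_bigcapmxP=> j _; apply/sub_kermx_lin_mx => //.
  by apply/valB; rewrite !rgenv !rgena.
- apply/sub_bigcapmxP=> i _; apply/sub_bigcapmxP=> j _; apply/sub_kermx_lin_mx => //.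
  by rewrite ursubmx_ZBM !rgena.
Qed.

Lemma coboundary_linear X Y : linear (@coboundary K Q X Y).
Proof.
move=> c u v; apply/row_matrixP=> g; rewrite linearP /= !rowK -linearP; congr mxvec.
by rewrite mulmxDl mulmxDr -scalemxAl -scalemxAr scalerBr opprD addrACA.
Qed.

Lemma dgen_coboundary X Y f g :
  dgen (@coboundary K Q X Y f) g = rgen Y g *m f - f *m rgen X g.
Proof. by rewrite /dgen rowK mxvecK. Qed.

End HomExtSpaces.

(** * Bricks and their extensions *)

Section Bricks.
Variables (K : fieldType) (Q : quiver) (src tgt : 'I_(qna Q) -> 'I_(qv Q)).
Hypotheses (srcE : forall a, qsrc a = (src a).+1) (tgtE : forall a, qtgt a = (tgt a).+1).
Implicit Types X Y : Emod K Q.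

(** * Module relations and cocycles normalized on the idempotents *)

Lemma vertM X i j : mvert X i *m mvert X j = if i == j then mvert X i else 0.
Proof. by case: (maxioms X). Qed.

Lemma vert_idem X i : mvert X i *m mvert X i = mvert X i.
Proof. by rewrite vertM eqxx. Qed.

Lemma vert_sum X : \sum_i mvert X i = 1%:M.
Proof. by case: (maxioms X). Qed.

Lemma vert_arr X i a : mvert X i *m marr X a = if i == tgt a then marr X a else 0.
Proof. by case: (maxioms X) => _ _ -> _ _; rewrite tgtE eqSS. Qed.

Lemma arr_vert X a i : marr X a *m mvert X i = if i == src a then marr X a else 0.
Proof. by case: (maxioms X) => _ _ _ -> _; rewrite srcE eqSS. Qed.

Lemma arrM X a b : marr X a *m marr X b = 0.
Proof. by case: (maxioms X). Qed.

(** A derivation vanishing on the idempotents: [d a] maps the component of [X] at [src a] to that of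
    [Y] at [tgt a], and the last clause is the Leibniz rule on paths of length two. *)
Definition graded_cocycle X Y (d : 'I_(qna Q) -> 'M[K]_(mdim Y, mdim X)) : Prop :=
  [/\ forall i a, mvert Y i *m d a = if i == tgt a then d a else 0,
      forall a i, d a *m mvert X i = if i == src a then d a else 0
    & forall a b, marr Y a *m d b + d a *m marr X b = 0].

(* The idempotents span a separable subalgebra, so a derivation is inner on them. *)
Lemma cocycle_normalize X Y D : @is_cocycle K Q X Y D -> exists f d,
  [/\ @graded_cocycle X Y d,
      forall i, dgen D (gv i) = mvert Y i *m f - f *m mvert X i
    & forall a, dgen D (ga a) = d a + (marr Y a *m f - f *m marr X a)].
Proof.
case=> vv v1 vx xv xx.
(* The primitive supplied by the separability idempotent $\sum_j e_j\otimes e_j$. *)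
pose f := - \sum_j dgen D (gv j) *m mvert X j.
have dv i : dgen D (gv i) = mvert Y i *m f - f *m mvert X i.
  rewrite mulmxN mulNmx opprK mulmx_sumr mulmx_suml.
  have -> : \sum_j dgen D (gv j) *m mvert X j *m mvert X i = dgen D (gv i) *m mvert X i.
    rewrite (bigD1 i) //= big1 ?addr0 => [|j /negPf ji]; rewrite -mulmxA vertM ?eqxx //.
    by rewrite ji mulmx0.
  (* The rule for $e_i e_j$ moves the derivation onto $e_i$; then the idempotents sum to one. *)
  have -> : \sum_j mvert Y i *m (dgen D (gv j) *m mvert X j) =
      dgen D (gv i) *m mvert X i - dgen D (gv i).
    rewrite -[X in _ - X]mulmx1 -(vert_sum X) mulmx_sumr -[X in X - _]addr0.
    rewrite [in RHS](bigD1 i) //= opprD addrA addr0 subrr add0r -sumrN (bigD1 i) //=.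
    rewrite mulmxA (canRL (addrK _) (vv i i)) eqxx mulmxBl -mulmxA vert_idem subrr add0r.
    apply: eq_bigr => j ji; rewrite mulmxA (canRL (addrK _) (vv i j)) eq_sym (negPf ji).
    by rewrite sub0r mulNmx -mulmxA vert_idem.
  by rewrite opprB subrK.
exists f, (fun a => dgen D (ga a) - (marr Y a *m f - f *m marr X a)); split=> //; last first.
  by move=> a; rewrite subrK.
split.
- move=> i a; rewrite mulmxBr (canRL (addrK _) (vx i a)) dv mulmxBl -!mulmxA vert_arr mulmxBr.
  rewrite !mulmxA vert_arr tgtE eqSS -[val i == _]/(i == tgt a); case: eqP => _.
    by rewrite -addrA -opprD [X in - X]addrC addrA subrK.
  by rewrite mul0mx mulmx0 subr0 !sub0r subrr.
- move=> a j; rewrite mulmxBl (canRL (addKr _) (xv a j)) dv mulmxBr mulmxBl !mulmxA arr_vert.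
  rewrite -!mulmxA arr_vert srcE eqSS -[val j == _]/(j == src a); case: eqP => _.
    by rewrite [- _ + _]addrC -addrA -opprD addrA subrK.
  by rewrite mul0mx mulmx0 subr0 sub0r opprK addr0 subrr.
move=> a b; rewrite mulmxBr mulmxBl mulmxBr mulmxBl !mulmxA arrM mul0mx.
rewrite -!mulmxA arrM mulmx0 sub0r subr0 opprK addrACA xx add0r subrr //.
Qed.

Lemma eq_dgen X Y (D D' : 'M[K]_(ngen Q, mdim Y * mdim X)) :
  (forall i, dgen D (gv i) = dgen D' (gv i)) -> (forall a, dgen D (ga a) = dgen D' (ga a)) ->
  D = D'.
Proof.
move=> Dv Da; apply/row_matrixP=> g; apply: (can_inj vec_mxK).
by case: (split_ordP g) => [i | a] ->; [exact: Dv | exact: Da].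
Qed.

Lemma dgen0 X Y g : dgen (0 : 'M[K]_(ngen Q, mdim Y * mdim X)) g = 0.
Proof. by rewrite /dgen row0 raddf0. Qed.

(** [dim_ext] is a truncated difference of ranks, so it vanishes once cocycles are coboundaries. The
    primitive of the graded part is added to the one from the normalization. *)
Lemma dim_ext_eq0 X Y :
  (forall d, @graded_cocycle X Y d -> exists f, (forall i, mvert Y i *m f = f *m mvert X i) /\
     forall a, d a = marr Y a *m f - f *m marr X a) ->
  dim_ext X Y = 0%N.
Proof.
move=> coboundary_of; apply/eqP; rewrite subn_eq0; apply/mxrankS/rV_subP=> v.
rewrite -(vec_mxK v) => /cocycle_spaceP/cocycle_normalize[f [d [d_graded Dv Da]]].
have [f' [f'v f'a]] := coboundary_of d d_graded.
have -> : vec_mx v = coboundary (f + f').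
  apply: eq_dgen => [i | a]; rewrite dgen_coboundary ?rgenv ?rgena mulmxDr mulmxDl opprD addrACA.
    by rewrite Dv f'v subrr addr0.
  by rewrite Da f'a addrC.
by rewrite -mul_vec_lin_of_linear ?submxMl //; exact: coboundary_linear.
Qed.

(** On a simple module all coboundaries vanish, and a cocycle is a free choice of one scalar for
    each loop at [i]. *)
Lemma dim_ext_simple X i : mdim X = 1%N ->
  (forall j, mvert X j = if j == i then 1%:M else 0) -> (forall a, marr X a = 0) ->
  dim_ext X X = #|[set a | (src a == i) && (tgt a == i)]|.
Proof.
move=> X1 Xv Xa; set L := [set a | _].
have -> : dim_ext X X = \rank (cocycle_space X X).
  rewrite /dim_ext [X in (_ - X)%N](_ : _ = 0%N) ?subn0 //.
  apply/eqP; rewrite mxrank_eq0; apply/eqP/row_matrixP=> k; rewrite rowE row0.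
  rewrite -[delta_mx 0 k]vec_mxK mul_vec_lin_of_linear; last exact: coboundary_linear.
  rewrite [coboundary _](_ : _ = 0) ?raddf0 //.
  apply: eq_dgen => [j | a]; rewrite dgen_coboundary dgen0 ?rgenv ?rgena ?Xv ?Xa.
    by case: eqP => _; rewrite ?mul1mx ?mulmx1 ?mul0mx ?mulmx0 subrr.
  by rewrite mul0mx mulmx0 subrr.
(* [P] includes the loops at [i] among the generators. Cocycles are exactly the products [P *m E],
   and [P^T] is a left inverse of [P], which gives the rank. *)
pose P : 'M[K]_(ngen Q, #|L|) := \matrix_(g, k) (g == ga (enum_val k))%:R.
have row_gv j : row (gv j) P = 0.
  by apply/rowP=> k; rewrite !mxE eq_lrshift.
have row_ga k : row (ga (enum_val k)) P = delta_mx 0 k.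
  by apply/rowP=> l; rewrite !mxE eq_rshift (inj_eq enum_val_inj) eq_sym.
have row_notin a : a \notin L -> row (ga a) P = 0.
  move=> aL; apply/rowP=> k; rewrite !mxE eq_rshift; case: eqP => // aE.
  by rewrite aE enum_valP in aL.
have PTP : P^T *m P = 1%:M.
  apply/row_matrixP=> k; apply/rowP=> l; rewrite !mxE (bigD1 (ga (enum_val k))) //= !mxE eqxx mul1r.
  rewrite eq_rshift (inj_eq enum_val_inj) big1 ?addr0 // => g /negPf gk.
  by rewrite !mxE gk mul0r.
have dgenP E j : dgen (P *m E) j = vec_mx (row j P *m E) :> 'M_(mdim X).
  by rewrite /dgen row_mul.
have ZP : (cocycle_space X X :=: lin_mulmx P)%MS.
  apply/eqmxP/andP; split; apply/rV_subP=> v.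
    rewrite -(vec_mxK v) => /cocycle_spaceP[vv _ vx xv _]; set D := vec_mx v in vv vx xv *.
    have Dv j : dgen D (gv j) = 0.
      move: (vv j j); rewrite eqxx Xv; case: eqP => _; last by rewrite mul0mx mulmx0 addr0.
      by rewrite mul1mx mulmx1 -[RHS]addr0 => /addrI.
    have Da a : a \notin L -> dgen D (ga a) = 0.
      rewrite inE negb_and => /orP[] aL.
        move: (xv a i); rewrite Xv Xa mul0mx add0r eqxx mulmx1 srcE eqSS.
        by rewrite -[val i == _]/(i == src a) eq_sym (negPf aL).
      move: (vx i a); rewrite Xv Xa mulmx0 addr0 eqxx mul1mx tgtE eqSS.
      by rewrite -[val i == _]/(i == tgt a) eq_sym (negPf aL).
    have -> : D = P *m rowsub (fun k : 'I_#|L| => ga (enum_val k)) D.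
      apply: eq_dgen => [j | a]; rewrite dgenP ?row_gv ?mul0mx ?raddf0 //.
      have [aL | aL] := boolP (a \in L); last by rewrite row_notin // mul0mx raddf0 Da.
      rewrite -(enum_rankK_in aL aL) row_ga -rowE; congr vec_mx.
      by apply/rowP=> l; rewrite !mxE.
    by rewrite -mul_vec_lin submxMl.
  case/submxP=> u ->; rewrite mul_rV_lin; apply/cocycle_spaceP; set E := vec_mx u.
  have Dv j : dgen (P *m E) (gv j) = 0 :> 'M_(mdim X) by rewrite dgenP row_gv mul0mx raddf0.
  have Da a : a \notin L -> dgen (P *m E) (ga a) = 0 :> 'M_(mdim X).
    by move=> aL; rewrite dgenP row_notin // mul0mx raddf0.
  split.
  - by move=> j k; rewrite !Dv mul0mx mulmx0 addr0 if_same.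
  - by rewrite big1.
  - move=> j a; rewrite Dv Xa mulmx0 addr0 tgtE eqSS -[val j == _]/(j == tgt a) Xv.
    have [|/Da ->] := boolP (a \in L); last by rewrite mulmx0 if_same.
    by rewrite inE => /andP[_ /eqP ->]; case: eqP; rewrite ?mul1mx ?mul0mx.
  - move=> a j; rewrite Dv Xa mulmx0 add0r srcE eqSS -[val j == _]/(j == src a) Xv.
    have [|/Da ->] := boolP (a \in L); last by rewrite mul0mx if_same.
    by rewrite inE => /andP[/eqP -> _]; case: eqP; rewrite ?mulmx1 ?mulmx0.
  - by move=> a b; rewrite !Xa mul0mx mulmx0 addr0.
suff: row_free (lin_mulmx P : 'M_(#|L| * (mdim X * mdim X), _)).
  by rewrite ZP => /eqP ->; rewrite X1 !muln1.
apply/row_freeP; exists (lin_mulmx P^T); apply/row_matrixP=> k.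
rewrite rowE mulmxA !mul_rV_lin /= mxvecK mulmxA PTP mul1mx vec_mxK row1 //.
Qed.

(** * Structure of bricks when non-loop arrows give each vertex at most one parent and two
    children *)

Hypothesis parent_uniq : forall a b,
  src a != tgt a -> src b != tgt b -> tgt a = tgt b -> a = b.
Hypothesis outdeg_le2 : forall a b c, src a != tgt a -> src b != tgt b -> src c != tgt c ->
  src a = src b -> src b = src c -> [|| a == b, b == c | a == c].


Definition brick X := (0 < mdim X)%N /\ dim_hom X X = 1%N.

Lemma brick_endo_eq0l X f n (u : 'M_(mdim X, n)) :
  brick X -> @is_hom K Q X X f -> u != 0 -> f *m u = 0 -> f = 0.
Proof.
case=> X_gt0 X1 /(endo_scalar X_gt0 X1)[c ->] u0 /eqP.
by rewrite mul_scalar_mx scaler_eq0 (negPf u0) orbF => /eqP ->; rewrite raddf0.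
Qed.

Lemma brick_endo_eq0r X f n (u : 'M_(n, mdim X)) :
  brick X -> @is_hom K Q X X f -> u != 0 -> u *m f = 0 -> f = 0.
Proof.
case=> X_gt0 X1 /(endo_scalar X_gt0 X1)[c ->] u0 /eqP.
by rewrite mul_mx_scalar scaler_eq0 (negPf u0) orbF => /eqP ->; rewrite raddf0.
Qed.

Lemma tgt_vert X a : mvert X (tgt a) *m marr X a = marr X a.
Proof. by rewrite vert_arr eqxx. Qed.

Lemma src_vert X a : marr X a *m mvert X (src a) = marr X a.
Proof. by rewrite arr_vert eqxx. Qed.

(* The composite X -> X/rad X -> soc Y -> Y through the vertex [src a = tgt b]. *)
Lemma is_hom_through X Y a b M :
  src a = tgt b -> @is_hom K Q X Y (marr Y b *m M *m marr X a).
Proof.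
move=> ab; split=> [k | c].
  by rewrite !mulmxA vert_arr -!mulmxA arr_vert ab; case: eqP; rewrite ?mul0mx ?mulmx0.
by rewrite !mulmxA arrM !mul0mx -!mulmxA arrM !mulmx0.
Qed.

(** The endomorphism [marr X b *m M *m marr X a] kills the nonzero image of [marr X b], so it is
    zero for every [M]. *)
Lemma brick_through X a b : brick X -> src a = tgt b -> marr X b != 0 -> marr X a = 0.
Proof.
move=> X_brick ab xb; apply: (mulmx_delta_eq0 _ xb) => M.
apply: (brick_endo_eq0l X_brick (is_hom_through M ab) xb).
by rewrite -!mulmxA arrM !mulmx0.
Qed.

Lemma brick_nonloop X a : brick X -> marr X a != 0 -> src a != tgt a.
Proof.
move=> X_brick xa; apply/eqP=> aa.
by move: (xa); rewrite (brick_through X_brick aa xa) eqxx.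
Qed.

Lemma vert_proj X (T : {set 'I_(qv Q)}) k :
  (mvert X k *m (\sum_(l in T) mvert X l) = if k \in T then mvert X k else 0) /\
  ((\sum_(l in T) mvert X l) *m mvert X k = if k \in T then mvert X k else 0).
Proof.
rewrite mulmx_sumr mulmx_suml; case: ifP => kT.
  by split; rewrite (bigD1 k) //= vert_idem big1 ?addr0 // => l /andP[_ /negPf lk];
    rewrite vertM ?[k == l]eq_sym lk.
by split; rewrite big1 // => l lT; rewrite vertM; case: eqP => // lk; move: lT kT; rewrite lk => ->.
Qed.

(** No acting arrow crosses the boundary of [T], so the projection onto the components in [T] is an
    endomorphism, hence a scalar; it is nonzero because of [i]. *)
Lemma brick_support X (T : {set 'I_(qv Q)}) i :
  brick X -> (forall a, marr X a != 0 -> (src a \in T) = (tgt a \in T)) ->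
  i \in T -> mvert X i != 0 -> forall k, mvert X k != 0 -> k \in T.
Proof.
move=> X_brick T_closed iT ei k ek; apply: contraNT ek => kT.
set g := \sum_(l in T) mvert X l.
have g_hom : is_hom g.
  split=> [l | a]; first by rewrite !(vert_proj X T l).1 (vert_proj X T l).2.
  have [-> | xa] := eqVneq (marr X a) 0; first by rewrite mul0mx mulmx0.
  transitivity (if src a \in T then marr X a else 0).
    by rewrite -{1}src_vert -mulmxA (vert_proj X T _).1; case: ifP; rewrite ?src_vert ?mulmx0.
  rewrite -{2}tgt_vert mulmxA (vert_proj X T _).2 T_closed //.
  by case: ifP; rewrite ?tgt_vert ?mul0mx.
have [X_gt0 X1] := X_brick; have [c gE] := endo_scalar X_gt0 X1 g_hom.
have := (vert_proj X T i).2; rewrite -/g gE iT mul_scalar_mx => cE.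
have c0 : c != 0 by apply: contraNneq ei => c0; rewrite -cE c0 scale0r.
have := (vert_proj X T k).2; rewrite -/g gE (negPf kT) mul_scalar_mx => /eqP.
by rewrite scaler_eq0 (negPf c0).
Qed.

(* A brick is either simple, or generated by its component at the vertex [i], the other
   components being copies of it along the arrows that start at [i] and act nontrivially. *)
Definition brick_top X i : Prop :=
  [/\ mvert X i != 0,
      forall a, tgt a = i -> marr X a = 0,
      forall a, marr X a != 0 -> src a = i,
      forall k, mvert X k != 0 -> k = i \/ exists2 a, marr X a != 0 & tgt a = k
    & exists w : 'I_(qna Q) -> 'M[K]_(mdim X), forall a, marr X a != 0 ->
        [/\ w a *m marr X a = mvert X i, marr X a *m w a = mvert X (tgt a),
            mvert X i *m w a = w a & w a *m mvert X (tgt a) = w a] ].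

(** If no arrow acts, the support is one vertex. Otherwise the source of an acting arrow is the top,
    and each acting arrow is shown to be onto its target component and then injective on the top
    component. *)
Lemma brick_has_top X : brick X -> exists i, brick_top X i.
Proof.
move=> X_brick; have [X_gt0 X1] := X_brick.
have [/existsP[a0 xa0] | /existsPn x0] := boolP [exists a, marr X a != 0]; last first.
  have {}x0 a : marr X a = 0 by apply/eqP; rewrite -[_ == _]negbK x0.
  have [/existsP[i ei] | /existsPn e0] := boolP [exists i, mvert X i != 0]; last first.
    have /eqP := vert_sum X; rewrite big1 => [|i _]; last by apply/eqP; rewrite -[_ == _]negbK e0.
    by rewrite eq_sym -mxrank_eq0 mxrank1 gtn_eqF.
  exists i; split=> // [a | k ek | ]; rewrite ?x0 ?eqxx //.
    left; apply/set1P; apply: (@brick_support X [set i] i) => // [a|]; rewrite ?x0 ?eqxx //.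
    by rewrite set11.
  by exists (fun _ => 0) => a; rewrite x0 eqxx.
set i := src a0.
have tgt_i a : tgt a = i -> marr X a = 0.
  by move=> ai; apply: contraNeq xa0 => xa; rewrite (brick_through X_brick (b:=a)).
have ei : mvert X i != 0.
  by apply: contraNneq xa0 => ei; rewrite -src_vert -/i ei mulmx0.
have nonloop a : marr X a != 0 -> src a != tgt a by exact: brick_nonloop.
(* A set closed under acting arrows in both directions, by [brick_through] and uniqueness of
   parents. *)
pose T := i |: [set tgt b | b in [set b | (marr X b != 0) && (src b == i)]].
have supp k : mvert X k != 0 -> k \in T.
  apply: (@brick_support X T i); rewrite ?setU11 // => a xa.
  apply/idP/idP.
    case/setU1P=> [ai | /imsetP[b]]; first by rewrite inE imset_f ?orbT // inE xa ai eqxx.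
    by rewrite inE => /andP[xb _] ab; rewrite (brick_through X_brick ab xb) eqxx in xa.
  case/setU1P=> [ai | /imsetP[b]]; first by rewrite tgt_i ?eqxx in xa.
  rewrite inE => /andP[xb /eqP bi] ab.
  by rewrite (parent_uniq (nonloop _ xa) (nonloop _ xb) ab) bi setU11.
have src_i a : marr X a != 0 -> src a = i.
  move=> xa; have : src a \in T.
    by apply: supp; apply: contraNneq xa => e0; rewrite -src_vert e0 mulmx0.
  case/setU1P=> // /imsetP[b]; rewrite inE => /andP[xb _] ab.
  by rewrite (brick_through X_brick ab xb) eqxx in xa.
exists i; split=> // [k /supp /setU1P[->|/imsetP[b]]|]; first by left.
  by rewrite inE => /andP[xb _] ->; right; exists b.
suff : forall a, exists w : 'M[K]_(mdim X), marr X a != 0 ->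
    [/\ w *m marr X a = mvert X i, marr X a *m w = mvert X (tgt a),
        mvert X i *m w = w & w *m mvert X (tgt a) = w].
  by move/fin_all_exists.
move=> b; have [->|xb] := eqVneq (marr X b) 0; first by exists 0.
have [G xGx] := generalized_inverse (marr X b); set k := tgt b.
have ik : i != k by rewrite -(src_i _ xb) nonloop.
have src_k a : marr X a *m mvert X k = 0.
  rewrite arr_vert; case: eqP => // ka; apply/eqP/negPn/negP=> xa.
  by rewrite ka (src_i _ xa) eqxx in ik.
have uniq_k a : marr X a != 0 -> tgt a = k -> a = b.
  by move=> xa; apply: parent_uniq; apply: nonloop.
have ek : mvert X k != 0 by apply: contraNneq xb => e0; rewrite -tgt_vert -/k e0 mul0mx.
(* Surjectivity: [1%:M - marr X b *m G] kills the image of [marr X b], the only acting arrow into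
   [k]. Hence [N] below is an endomorphism killing that image, so it is zero. *)
have xGe : marr X b *m G *m mvert X k = mvert X k.
  apply/eqP; rewrite eq_sym -subr_eq0 -[X in X - _]mul1mx -mulmxBl; apply/eqP.
  apply: (mulmx_delta_eq0 _ ek) => M.
  set N := _ *m _ *m _.
  have N_hom : @is_hom K Q X X N.
    split=> [l | a]; rewrite /N.
      by rewrite !mulmxA vertM -!mulmxA vertM eq_sym; case: eqP => [<-|]; rewrite ?mul0mx ?mulmx0.
    rewrite !mulmxA src_k !mul0mx -!mulmxA vert_arr; case: eqP => [ka|]; rewrite ?mulmx0 //.
    have [->|xa] := eqVneq (marr X a) 0; first by rewrite !mulmx0.
    by rewrite (uniq_k a) // mulmxBl mul1mx xGx subrr !mulmx0.
  apply: (brick_endo_eq0l X_brick N_hom xb).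
  by rewrite /N -!mulmxA tgt_vert mulmxBl mul1mx xGx subrr !mulmx0.
pose w := mvert X i *m G *m mvert X k.
have xw : marr X b *m w = mvert X k by rewrite /w !mulmxA -(src_i _ xb) src_vert xGe.
exists w => _; split; rewrite // ?/w -?mulmxA ?vert_idem ?mulmxA ?vert_idem // -/w.
(* The projection of the top component onto the kernel of [marr X b]; injectivity means that it is
   zero. *)
pose p := mvert X i - w *m marr X b.
have ep l : mvert X l *m p = if l == i then p else 0.
  by rewrite mulmxBr /w !mulmxA vertM; case: eqP => [->|] //; rewrite !mul0mx subr0.
have xp : marr X b *m p = 0.
  by rewrite mulmxBr mulmxA xw tgt_vert -{1}(src_i _ xb) src_vert subrr.
suff p0 : p = 0 by apply/esym/eqP; rewrite -subr_eq0 -/p p0.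
clearbody p.
have [/existsP[c /andP[cb xc]] | /existsPn only_b] :=
    boolP [exists c, (c != b) && (marr X c != 0)]; last first.
  (* If [b] alone acts, any [p *m M *m mvert X i] is an endomorphism with image killed by all
     arrows. *)
  apply/eqP; apply: contraNT ei => p_neq0; apply/eqP; apply: (mulmx_delta_eq0 _ p_neq0) => M.
  have only_b' a : marr X a *m (p *m M *m mvert X i) = 0.
    have [->|ab] := eqVneq a b; first by rewrite !mulmxA xp !mul0mx.
    by have := only_b a; rewrite ab negbK => /eqP ->; rewrite mul0mx.
  apply: (brick_endo_eq0r X_brick _ xb); last exact: only_b'.
  split=> [l | a].
    by rewrite !mulmxA ep -!mulmxA vertM eq_sym; case: eqP => [->|]; rewrite ?mul0mx ?mulmx0.
  rewrite only_b' -!mulmxA vert_arr; case: eqP; rewrite ?mulmx0 // => ia.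
  by rewrite tgt_i // !mulmx0.
apply/eqP; apply: contraNT (xc) => p_neq0; apply/eqP; apply: (mulmx_delta_eq0 _ p_neq0) => M.
(* The endomorphism [p *m M *m marr X c] of the top component takes values in the kernel of
   [marr X b]; the second summand is the matching map at [tgt c]. The two-children bound excludes a
   third acting arrow. As [marr X b] kills the image of [f], [f] is zero. *)
pose f := p *m M *m marr X c + marr X c *m p *m M *m mvert X (tgt c).
have bc : tgt b != tgt c.
  by apply: contraNneq cb => bc; rewrite (parent_uniq (nonloop _ xc) (nonloop _ xb)).
have f_hom : @is_hom K Q X X f.
  split=> [l | a].
    rewrite mulmxDr mulmxDl !mulmxA ep vert_arr; congr (_ + _); rewrite -!mulmxA.
      by rewrite arr_vert (src_i _ xc); case: eqP; rewrite ?mulmx0 ?mul0mx.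
    by rewrite vertM eq_sym; case: eqP => [->|]; rewrite ?mulmx0 ?mul0mx.
  have [->|xa] := eqVneq (marr X a) 0; first by rewrite mul0mx mulmx0.
  have -> : marr X a *m f = marr X a *m p *m M *m marr X c.
    by rewrite mulmxDr !mulmxA arrM !mul0mx addr0.
  have -> : f *m marr X a = marr X c *m p *m M *m (mvert X (tgt c) *m marr X a).
    by rewrite mulmxDl -!mulmxA arrM !mulmx0 add0r.
  have [-> | ab] := eqVneq a b.
    by rewrite xp !mul0mx vert_arr eq_sym (negPf bc) mulmx0.
  have -> : a = c; last by rewrite tgt_vert.
  have := outdeg_le2 (nonloop _ xa) (nonloop _ xb) (nonloop _ xc).
  rewrite !src_i // => /(_ erefl erefl).
  by rewrite (negPf ab) eq_sym (negPf cb) => /eqP.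
have f0 : f = 0.
  apply: (brick_endo_eq0r X_brick f_hom xb).
  by rewrite mulmxDr !mulmxA xp arrM !mul0mx addr0.
have := congr1 (mulmx (mvert X i)) f0; rewrite mulmx0 mulmxDr !mulmxA ep eqxx vert_arr.
case: eqP => [ic|_]; last by rewrite !mul0mx addr0.
by move: (xc); rewrite tgt_i // eqxx.
Qed.

(** * Extensions between bricks, controlled by depth in the tree *)

Variable depth : 'I_(qv Q) -> nat.
Hypothesis depthS : forall a, src a != tgt a -> depth (tgt a) = (depth (src a)).+1.

Lemma top_nonloop X i a : brick_top X i -> marr X a != 0 -> src a != tgt a.
Proof.
case=> _ tgt_i src_i _ _ xa; rewrite (src_i a xa).
by apply: contraNneq xa => ia; rewrite tgt_i.
Qed.

(** The composite X -> S_i -> soc Y -> Y is a homomorphism, since no arrow acting on [X] ends at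
    [i]. *)
Lemma orthogonal_top X Y i a :
  dim_hom X Y = 0%N -> brick_top X i -> tgt a = i -> marr Y a = 0.
Proof.
move=> XY0 [ei tgt_i _ _ _] ai; apply/eqP; apply: contraNT ei => ya; apply/eqP.
apply: (mulmx_delta_eq0 _ ya) => M; apply: (hom_eq0 XY0); split=> [l | b].
  by rewrite !mulmxA vert_arr -!mulmxA vertM ai eq_sym; case: eqP => [->|];
    rewrite ?mul0mx ?mulmx0.
rewrite !mulmxA arrM !mul0mx -!mulmxA vert_arr; case: eqP => [ib|]; rewrite ?mulmx0 //.
by rewrite tgt_i // !mulmx0.
Qed.

(** [X] is generated by its top and its other components are copies of it, so any linear map between
    the top components extends. *)
Lemma hom_between_tops X Y i : brick_top X i -> brick_top Y i ->
  (forall a, marr Y a != 0 -> marr X a != 0) -> dim_hom X Y != 0%N.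
Proof.
move=> topX topY sub_YX; have [ei tgt_i _ _ [w wP]] := topX.
have [eYi tgtY_i _ _ _] := topY.
apply: contraNneq ei => XY0; apply/eqP; apply: (mulmx_delta_eq0 _ eYi) => M.
set M0 := _ *m _ *m _.
have eM l : mvert Y l *m M0 = if l == i then M0 else 0.
  by rewrite /M0 !mulmxA vertM; case: eqP => [->|] //; rewrite !mul0mx.
have Me l : M0 *m mvert X l = if l == i then M0 else 0.
  by rewrite /M0 -!mulmxA vertM eq_sym; case: eqP => _ //; rewrite !mulmx0.
clearbody M0.
(* On the component at [tgt b] go back to the top by [w b], apply [M0], and follow [b] in [Y]. *)
pose f := M0 + \sum_(b | marr X b != 0) marr Y b *m M0 *m w b.
have f_hom : is_hom f.
  split=> [l | a]; rewrite mulmxDr mulmxDl mulmx_sumr mulmx_suml.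
    rewrite eM Me; congr (_ + _); apply: eq_bigr => b xb; have [_ _ _ wt] := wP b xb.
    rewrite !mulmxA vert_arr -[in RHS]wt -!mulmxA vertM eq_sym.
    by case: eqP => _; rewrite ?wt ?mulmxA ?mul0mx ?mulmx0.
  rewrite big1 ?addr0 => [|b _]; last by rewrite !mulmxA arrM !mul0mx.
  have [xa|xa] := eqVneq (marr X a) 0.
    have -> : marr Y a = 0 by apply/eqP; apply: contraTT isT => /sub_YX; rewrite xa eqxx.
    by rewrite xa mul0mx mulmx0 big1 ?addr0 // => b _; rewrite mulmx0.
  rewrite -{1}(tgt_vert X a) mulmxA Me; case: eqP => [ai|_]; first by rewrite tgt_i // eqxx in xa.
  rewrite mul0mx add0r (bigD1 a) //= big1 ?addr0 => [|b /andP[xb ba]].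
    have [wx _ _ _] := wP a xa; rewrite -[RHS]mulmxA wx -[RHS]mulmxA Me eqxx //.
  have [_ _ _ wt] := wP b xb; rewrite -wt -!mulmxA vert_arr; case: eqP => [ab|]; rewrite ?mulmx0 //.
  by rewrite (parent_uniq (top_nonloop topX xb) (top_nonloop topX xa) ab) eqxx in ba.
have := congr1 (mulmx (mvert Y i)) (hom_eq0 XY0 f_hom).
rewrite mulmx0 mulmxDr eM eqxx mulmx_sumr big1 ?addr0 // => b _.
by rewrite !mulmxA vert_arr; case: eqP => [ib|_]; rewrite ?tgtY_i // !mul0mx.
Qed.

Lemma graded_cocycle_support X Y d a : @graded_cocycle X Y d -> d a != 0 ->
  mvert X (src a) != 0 /\ mvert Y (tgt a) != 0.
Proof.
case=> dt ds _ da; split; apply: contraNneq da => e0.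
  by have := ds a (src a); rewrite eqxx e0 mulmx0 => <-.
by have := dt (tgt a) a; rewrite eqxx e0 mul0mx => <-.
Qed.

(** Values on acting arrows are removed by a primitive built from the inverses [w]; values on the
    other arrows are zero by the Leibniz rule, acting arrows being injective on the top and onto
    their targets. *)
Lemma ext_nonsimple_brick X i a0 : brick_top X i -> marr X a0 != 0 -> dim_ext X X = 0%N.
Proof.
move=> topX xa0; have [ei tgt_i src_i supp [w wP]] := topX.
apply: dim_ext_eq0 => d d_graded; have [dt ds dd] := d_graded.
have [w0x _ _ _] := wP a0 xa0.
exists (- \sum_(b | marr X b != 0) d b *m w b); split=> [l | a]; rewrite mulmxN mulNmx.
  rewrite mulmx_sumr mulmx_suml; congr (- _); apply: eq_bigr => b xb.
  have [_ _ _ wt] := wP b xb.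
  rewrite mulmxA dt -[in RHS]wt -!mulmxA vertM eq_sym.
  by case: eqP => _; rewrite ?wt ?mulmxA ?mul0mx ?mulmx0.
rewrite opprK mulmx_sumr mulmx_suml big1 ?oppr0 ?add0r; last first.
  move=> b xb; rewrite mulmxA; have [->|xa] := eqVneq (marr X a) 0; first by rewrite !mul0mx.
  have := dt (tgt b) b; rewrite eqxx => <-; rewrite !mulmxA arr_vert (src_i _ xa).
  by rewrite -(src_i _ xb) eq_sym (negPf (top_nonloop topX xb)) !mul0mx.
(* If [a] does not act and ends at the top, [marr X a0] kills the image of [d a] but is injective
   there. If it ends at a child, it is a loop, and [d a] kills the image of the acting arrow onto
   that child. *)
have [xa|xa] := eqVneq (marr X a) 0.
  rewrite xa big1 => [|b _]; last by rewrite mulmx0.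
  apply/eqP; apply/negPn/negP => da.
  have [_ /supp[ai | [c xc ac]]] := graded_cocycle_support d_graded da.
    have := dd a0 a; rewrite xa mulmx0 addr0 => /(congr1 (mulmx (w a0))).
    by rewrite mulmxA w0x mulmx0 dt ai eqxx; apply/eqP.
  have [a_loop | a_nonloop] := eqVneq (src a) (tgt a); last first.
    by move: (xc); rewrite (parent_uniq (top_nonloop topX xc) a_nonloop ac) xa eqxx.
  have [_ xw _ _] := wP c xc.
  have := dd a c; rewrite xa mul0mx add0r => /(congr1 (mulmx^~ (w c))).
  by rewrite -mulmxA xw mul0mx ac -a_loop ds eqxx; apply/eqP.
rewrite (bigD1 a) //= big1 ?addr0 => [|b /andP[xb ba]].
  by have [wx _ _ _] := wP a xa; rewrite -mulmxA wx ds (src_i _ xa) eqxx.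
have [_ _ _ wt] := wP b xb; rewrite -wt -!mulmxA vert_arr; case: eqP => [ab|]; rewrite ?mulmx0 //.
by rewrite (parent_uniq (top_nonloop topX xb) (top_nonloop topX xa) ab) eqxx in ba.
Qed.

Lemma ext_simple_brick X i : brick X -> brick_top X i -> (forall a, marr X a = 0) ->
  dim_ext X X = #|[set a | (src a == i) && (tgt a == i)]|.
Proof.
move=> [X_gt0 X1] [_ _ _ supp _] x0.
have e0 k : k != i -> mvert X k = 0.
  move=> ki; apply/eqP; apply: contraNT ki => /supp[-> //|[a]].
  by rewrite x0 eqxx.
have ei : mvert X i = 1%:M by rewrite -(vert_sum X) (bigD1 i) //= big1 ?addr0.
have eE k : mvert X k = if k == i then 1%:M else 0 by case: eqP => [->|/eqP/e0].
apply: dim_ext_simple => //.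
(* With a single vertex in the support every matrix is an endomorphism, so a matrix unit is scalar;
   its rank one forces dimension one. *)
pose j := Ordinal X_gt0.
have [|c cE] := endo_scalar X_gt0 X1 (f := delta_mx j j).
  split=> [k | a]; last by rewrite x0 mul0mx mulmx0.
  by rewrite eE; case: eqP; rewrite ?mul1mx ?mulmx1 ?mul0mx ?mulmx0.
have := mxrank_delta K j j; rewrite cE -scalemx1.
have [->|c0] := eqVneq c 0; first by rewrite scale0r mxrank0.
by rewrite mxrank_scale_nz // mxrank1.
Qed.

(** A nonzero [d a] starts in the support of [X] and ends in that of [Y]. For distinct tops this
    contradicts depth, orthogonality or uniqueness of parents; for a common top, a primitive
    exists. *)
Lemma ext_orthogonal_bricks X Y i j :
  dim_hom X Y = 0%N -> dim_hom Y X = 0%N -> brick_top X i -> brick_top Y j ->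
  (depth j <= depth i)%N -> dim_ext X Y = 0%N.
Proof.
move=> XY0 YX0 topX topY ji.
have [_ tgtX srcX suppX _] := topX; have [_ tgtY srcY suppY [w wP]] := topY.
have nlX a := top_nonloop topX (a := a); have nlY a := top_nonloop topY (a := a).
have depthX a : marr X a != 0 -> depth (tgt a) = (depth i).+1.
  by move=> xa; rewrite depthS ?nlX // srcX.
have depthY a : marr Y a != 0 -> depth (tgt a) = (depth j).+1.
  by move=> ya; rewrite depthS ?nlY // srcY.
apply: dim_ext_eq0 => d d_graded; have [dt ds dd] := d_graded.
have [ij | ij] := eqVneq i j; last first.
  exists 0; split=> [l | a]; rewrite !mulmx0 !mul0mx ?subrr //.
  apply/eqP/negPn/negP => /(graded_cocycle_support d_graded)[/suppX Xa /suppY Ya].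
  have [a_loop | a_nl] := eqVneq (src a) (tgt a).
    move: Xa Ya; rewrite a_loop => -[-> | [b xb <-]] [// | [c yc]].
    - by move/eqP: ij.
    - by move=> ci; rewrite (orthogonal_top XY0 topX ci) eqxx in yc.
    - by move=> bj; move: ji; rewrite -bj depthX // ltnn.
    - move=> cb; have bc := parent_uniq (nlY _ yc) (nlX _ xb) cb.
      by move: ij; rewrite -(srcX _ xb) -bc (srcY _ yc) eqxx.
  have da := depthS a_nl.
  case: Ya => [aj | [c yc ca]].
    case: Xa => [ai | [b xb ba]]; first by move: ji; rewrite -aj da ai ltnn.
    by move: ji; rewrite -aj da -ba depthX // ltnNge leqW // leqW.
  move: Xa; rewrite -(parent_uniq (nlY _ yc) a_nl ca) (srcY _ yc) => -[ji' | [b xb bj]].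
    by rewrite ji' eqxx in ij.
  by move: ji; rewrite -bj depthX // ltnn.
rewrite -{j}ij in topY suppY srcY tgtY wP depthY ji *.
(* By [hom_between_tops], each of [X] and [Y] has an acting arrow that does not act on the other.
   With at most two children, [b] alone acts on [Y] and [b'] alone on [X]. *)
have [b yb xb] : exists2 b, marr Y b != 0 & marr X b = 0.
  have [/existsP[b /andP[yb /eqP xb]] | /existsPn sub] :=
    boolP [exists b, (marr Y b != 0) && (marr X b == 0)]; first by exists b.
  have : dim_hom X Y != 0%N; last by rewrite XY0.
  by apply: (hom_between_tops topX topY) => a ya; have := sub a; rewrite ya.
have [b' xb' yb'] : exists2 b, marr X b != 0 & marr Y b = 0.
  have [/existsP[c /andP[xc /eqP yc]] | /existsPn sub] :=
    boolP [exists b, (marr X b != 0) && (marr Y b == 0)]; first by exists c.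
  have : dim_hom Y X != 0%N; last by rewrite YX0.
  by apply: (hom_between_tops topY topX) => a ya; have := sub a; rewrite ya.
have bb' : b != b' by apply: contraNneq yb => ->; rewrite yb'.
have onlyY a : marr Y a != 0 -> a = b.
  move=> ya; have := outdeg_le2 (nlY _ ya) (nlY _ yb) (nlX _ xb').
  rewrite (srcY a) // (srcY b) // (srcX b') // => /(_ erefl erefl); rewrite (negPf bb').
  by case/orP=> /eqP // ab'; rewrite ab' yb' eqxx in ya.
have onlyX a : marr X a != 0 -> a = b'.
  move=> xa; have := outdeg_le2 (nlX _ xa) (nlY _ yb) (nlX _ xb').
  rewrite (srcX a) // (srcY b) // (srcX b') // => /(_ erefl erefl); rewrite (negPf bb').
  by case/orP=> /eqP // ab; rewrite ab xb eqxx in xa.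
have [wy yw ew _] := wP b yb.
(* Following [b] in [Y] after this map returns [d b]; on the [X] side nothing is added, as no acting
   arrow ends at [i]. *)
exists (w b *m d b); split=> [l | a].
  rewrite -ew !mulmxA vertM -!mulmxA ds (srcY _ yb).
  by case: eqP => [->|]; rewrite ?mul0mx ?mulmx0.
have -> : w b *m d b *m marr X a = 0.
  have := ds b i; rewrite (srcY _ yb) eqxx => <-.
  by rewrite -!mulmxA vert_arr; case: eqP => [ia|]; rewrite ?tgtX ?mulmx0.
rewrite subr0; have [-> | ab] := eqVneq a b; first by rewrite mulmxA yw dt eqxx.
have -> : marr Y a = 0 by apply/eqP; apply: contraNT ab => /onlyY ->.
rewrite mul0mx; apply/eqP/negPn/negP => da.
have [/suppX Xa /suppY Ya] := graded_cocycle_support d_graded da.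
(* An arrow into [i] is excluded by injectivity of [marr Y b]. Any other one would be a loop at
   [tgt b], which lies outside the support of [X]. *)
case: Ya => [ai | [c /onlyY -> {c} ba]].
  have := dd b a; rewrite (tgtX _ ai) mulmx0 addr0 => /(congr1 (mulmx (w b))).
  by rewrite mulmxA wy mulmx0 dt ai eqxx; apply/eqP.
have [a_loop | a_nl] := eqVneq (src a) (tgt a); last first.
  by rewrite (parent_uniq (nlY _ yb) a_nl ba) eqxx in ab.
move: Xa; rewrite a_loop -ba => -[bi | [c /onlyX -> {c} b'b]].
  by have := nlY _ yb; rewrite bi (srcY _ yb) eqxx.
by rewrite (parent_uniq (nlX _ xb') (nlY _ yb) b'b) eqxx in bb'.
Qed.

End Bricks.

(** * Spectral radius, simple modules and the quiver of E(n) *)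

(* Look at an eigenvector at an index of minimal height in its support. *)
Lemma eigenvalue_height_triangular (F : fieldType) m (A : 'M[F]_m) (h : 'I_m -> nat) z :
  (forall p q, p != q -> A p q != 0 -> (h p < h q)%N) -> eigenvalue A z ->
  exists q, z = A q q.
Proof.
move=> A_tri /eigenvalueP[v vA /matrix0Pn[i [q0]]]; rewrite (ord1 i) => vq0.
case: (@arg_minnP _ q0 (fun q => v 0 q != 0) h vq0) => q vq q_min; exists q.
have := congr1 (fun u : 'rV_m => u 0 q) vA; rewrite !mxE (bigD1 q) //= big1 ?addr0.
  by rewrite mulrC => /(mulIf vq).
move=> p pq; have [-> | vp] := eqVneq (v 0 p) 0; first by rewrite mul0r.
have [-> | Apq] := eqVneq (A p q) 0; first by rewrite mulr0.
by have := q_min p vp; rewrite leqNgt A_tri.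
Qed.

Lemma spectral_radius_roots m (A : 'M[algC]_m) :
  exists r : seq algC, [/\ size r = m, forall z, z \in r -> eigenvalue A z
    & spectral_radius A = \big[Num.max/0]_(z <- r) `|z|].
Proof.
rewrite /spectral_radius; case: closed_field_poly_normal => r /=.
rewrite (monicP (char_poly_monic A)) scale1r => rE; exists r; split=> // [|z zr].
  by have := size_char_poly A; rewrite rE size_prod_XsubC => -[].
by rewrite eigenvalue_root_char rE root_prod_XsubC.
Qed.

Lemma spectral_radius_le m (A : 'M[algC]_m) s :
  0 <= s -> (forall z, eigenvalue A z -> `|z| <= s) -> spectral_radius A <= s.
Proof.
have [r [_ r_eigen ->]] := spectral_radius_roots A; move=> s0 A_le.
rewrite big_seq; apply: (big_ind (fun x => x <= s)) => // [x y xs ys | z /r_eigen/A_le //].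
by rewrite /Num.max; case: ifP.
Qed.

Lemma spectral_radius_mx11 (A : 'M[algC]_1) : 0 <= A 0 0 -> spectral_radius A = A 0 0.
Proof.
move=> A_ge0; have [r [r_size r_eigen ->]] := spectral_radius_roots A.
case: r r_size r_eigen => [|z []] // _ r_eigen.
have [|q zA] := eigenvalue_height_triangular (h := fun=> 0%N) _ (r_eigen z (mem_head _ _)).
  by move=> p q; rewrite !ord1.
by rewrite big_cons big_nil zA ord1 ger0_norm // /Num.max le_gtF.
Qed.

Lemma simple_is_Emod (K : fieldType) (Q : quiver) (i : 'I_(qv Q)) :
  is_Emod (fun j => if j == i then 1%:M else 0 : 'M[K]_1) (fun _ : 'I_(qna Q) => 0).
Proof.
split=> [j k | | j a | a j | a b]; rewrite ?mulmx0 ?mul0mx ?if_same //.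
  case: (j =P i) => [->|_]; last by rewrite mul0mx if_same.
  by rewrite eq_sym; case: ifP => _; rewrite ?mulmx1 ?mulmx0.
by rewrite -big_mkcond big_pred1_eq.
Qed.

Definition simple_Emod (K : fieldType) (Q : quiver) (i : 'I_(qv Q)) : Emod K Q :=
  EMod (simple_is_Emod K i).

Lemma dim_hom_simple (K : fieldType) (Q : quiver) (i : 'I_(qv Q)) :
  dim_hom (simple_Emod K i) (simple_Emod K i) = 1%N.
Proof.
apply/eqP; rewrite eqn_leq (rank_leq_col (hom_space _ _)) lt0n; apply/eqP=> h0.
have := hom_eq0 h0 (is_hom_id _) => /eqP.
by rewrite -mxrank_eq0 mxrank1.
Qed.

(** * The quiver of E(n): a rooted tree with loops attached *)

Definition tree_arrows n : seq (nat * nat) :=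
  [:: (1, 3); (3, 4); (4, 2)]%N ++ [seq (i.-1, i) | i <- iota 5 (n - 4)].

Definition loop_arrows n (N : 'I_n -> nat) : seq (nat * nat) :=
  flatten [seq nseq (N i) (i.+1, i.+1) | i <- enum 'I_n].

Lemma qarr_En n (N : 'I_n -> nat) : qarr (En_quiver N) = tree_arrows n ++ loop_arrows N.
Proof. by []. Qed.

Lemma tree_arrowsP n s t : (s, t) \in tree_arrows n ->
  [\/ s = 1%N /\ t = 3%N, s = 3%N /\ t = 4%N, s = 4%N /\ t = 2%N
    | [/\ (5 <= t)%N, (t <= n)%N & s = t.-1] ].
Proof.
rewrite mem_cat => /orP[|/mapP[i]].
  rewrite !inE => /or3P[] /eqP[-> ->]; by [constructor 1 | constructor 2 | constructor 3].
by rewrite mem_iota => i_n [-> ->]; constructor 4; split; lia.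
Qed.

Lemma tree_arrows_uniq n : uniq (tree_arrows n).
Proof.
rewrite cat_uniq map_inj_uniq ?iota_uniq ?andbT => [|i j [_]] //=.
apply/hasPn=> -[s t] /mapP[i]; rewrite mem_iota => i_n [-> ->].
by rewrite !inE !xpair_eqE; lia.
Qed.

Lemma mem_loop_arrows n (N : 'I_n -> nat) s t :
  (s, t) \in loop_arrows N -> exists2 i : 'I_n, s = i.+1 & t = i.+1.
Proof.
by case/flatten_mapP=> i _; rewrite mem_nseq => /andP[_ /eqP[-> ->]]; exists i.
Qed.

Lemma count_loop_arrows n (N : 'I_n -> nat) (i : 'I_n) :
  count_mem (i.+1, i.+1) (loop_arrows N) = N i.
Proof.
rewrite count_flatten -map_comp sumnE big_map big_enum (bigD1 i) //= count_nseq /= eqxx mul1n.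
rewrite big1 ?addn0 // => j /negPf ji.
by rewrite count_nseq /= xpair_eqE !eqSS -[val j == val i]/(j == i) ji.
Qed.

Lemma card_nth_eq (T : eqType) (x0 : T) (s : seq T) y :
  #|[set a : 'I_(size s) | nth x0 s a == y]| = count_mem y s.
Proof. by rewrite -sum1_count (big_nth x0) big_mkord -sum1dep_card. Qed.

(** Distance from the root 1 along 1 -> 3 -> 4, where the tree branches to 2 and to 5 -> 6 -> ... *)
Definition tree_depth (k : nat) : nat :=
  match k with 1 => 0 | 2 => 3 | 3 => 1 | _ => k.-2 end.

Section EnQuiver.
Variables (n : nat) (N : 'I_n -> nat).
Let Q := En_quiver N.

Lemma En_arrow_mem (a : 'I_(qna Q)) :
  (qsrc a, qtgt a) \in tree_arrows n ++ loop_arrows N.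
Proof. by rewrite -surjective_pairing -qarr_En mem_nth. Qed.

(** The labels 2, 3 and 4 are vertices as soon as $n\geq 4$, so natural-number labels can be
    replaced by ordinals. *)
Lemma En_endpoints : (4 <= n)%N -> exists st : 'I_(qna Q) -> 'I_n * 'I_n,
  forall a, qsrc a = (st a).1.+1 /\ qtgt a = (st a).2.+1.
Proof.
move=> n_ge4; suff : forall a : 'I_(qna Q),
    exists st : 'I_n * 'I_n, qsrc a = st.1.+1 /\ qtgt a = st.2.+1.
  by move/fin_all_exists.
move=> a; suff [s_n t_n] : (0 < qsrc a <= n)%N /\ (0 < qtgt a <= n)%N.
  have s_lt : ((qsrc a).-1 < n)%N by lia.
  have t_lt : ((qtgt a).-1 < n)%N by lia.
  by exists (Ordinal s_lt, Ordinal t_lt); split=> /=; lia.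
have := En_arrow_mem a; rewrite mem_cat => /orP[/tree_arrowsP | /mem_loop_arrows].
  by case=> [[-> ->] | [-> ->] | [-> ->] | [? ? ->]]; split; lia.
by case=> i -> ->; rewrite !ltn_ord.
Qed.

Lemma En_nonloop (a : 'I_(qna Q)) : qsrc a != qtgt a ->
  (a < size (tree_arrows n))%N /\ (qsrc a, qtgt a) \in tree_arrows n.
Proof.
move=> a_nl; suff a_lt : (a < size (tree_arrows n))%N.
  by split=> //; rewrite -surjective_pairing -/Q qarr_En nth_cat a_lt mem_nth.
rewrite ltnNge; apply: contraNN a_nl => a_ge.
have : (qsrc a, qtgt a) \in loop_arrows N.
  rewrite -surjective_pairing qarr_En nth_cat ltnNge a_ge mem_nth //.
  by rewrite ltn_subLR // -size_cat -qarr_En.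
by case/mem_loop_arrows=> i -> ->.
Qed.

(** Arrows are positions in a list. Loops may be repeated, but non-loop arrows lie in the initial
    segment, which has no duplicates. *)
Lemma En_nonloop_inj (a b : 'I_(qna Q)) : qsrc a != qtgt a -> qsrc b != qtgt b ->
  qsrc a = qsrc b -> qtgt a = qtgt b -> a = b.
Proof.
move=> /En_nonloop[a_lt _] /En_nonloop[b_lt _] ab ab'; apply/val_inj/eqP => /=.
rewrite -(nth_uniq (0, 0)%N a_lt b_lt (tree_arrows_uniq n)).
have nthE c : (c < size (tree_arrows n))%N ->
    nth (0, 0)%N (tree_arrows n) c = nth (0, 0)%N (qarr Q) c.
  by move=> c_lt; rewrite qarr_En nth_cat c_lt.
rewrite !nthE // [X in X == _]surjective_pairing [X in _ == X]surjective_pairing.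
by rewrite -/(qsrc a) -/(qtgt a) ab ab'.
Qed.

Lemma En_parent_uniq (a b : 'I_(qna Q)) : qsrc a != qtgt a -> qsrc b != qtgt b ->
  qtgt a = qtgt b -> a = b.
Proof.
move=> a_nl b_nl ab; apply: En_nonloop_inj => //.
have [_ /tree_arrowsP a_tree] := En_nonloop a_nl; have [_ /tree_arrowsP b_tree] := En_nonloop b_nl.
by case: a_tree b_tree => [[? ?] | [? ?] | [? ?] | [? ? ?]] [[? ?] | [? ?] | [? ?] | [? ? ?]]; lia.
Qed.

(** Only vertex 4 can have two children, namely 2 and 5. *)
Lemma En_outdeg_le2 (a b c : 'I_(qna Q)) :
  qsrc a != qtgt a -> qsrc b != qtgt b -> qsrc c != qtgt c ->
  qsrc a = qsrc b -> qsrc b = qsrc c -> [|| a == b, b == c | a == c].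
Proof.
move=> a_nl b_nl c_nl ab bc.
have [_ /tree_arrowsP a_tree] := En_nonloop a_nl; have [_ /tree_arrowsP b_tree] := En_nonloop b_nl.
have [_ /tree_arrowsP c_tree] := En_nonloop c_nl.
have : [\/ qtgt a = qtgt b, qtgt b = qtgt c | qtgt a = qtgt c].
  suff : [|| qtgt a == qtgt b, qtgt b == qtgt c | qtgt a == qtgt c].
    by case/or3P=> /eqP; [constructor 1 | constructor 2 | constructor 3].
  case: a_tree => [[? ?] | [? ?] | [? ?] | [? ? ?]];
  case: b_tree => [[? ?] | [? ?] | [? ?] | [? ? ?]];
  case: c_tree => [[? ?] | [? ?] | [? ?] | [? ? ?]]; lia.
by case=> /En_parent_uniq ->; rewrite ?eqxx ?orbT.
Qed.

Lemma En_depth (a : 'I_(qna Q)) : qsrc a != qtgt a ->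
  tree_depth (qtgt a) = (tree_depth (qsrc a)).+1.
Proof.
case/En_nonloop=> _ /tree_arrowsP[[-> ->] | [-> ->] | [-> ->] | [t5 _ ->]] //.
by case: (qtgt a) t5 => [|[|[|[|[|[|k]]]]]].
Qed.

Lemma En_card_loops (i : 'I_n) :
  #|[set a : 'I_(qna Q) | (qsrc a == i.+1) && (qtgt a == i.+1)]| = N i.
Proof.
rewrite -[RHS]count_loop_arrows -[RHS]add0n -(_ : count_mem (i.+1, i.+1) (tree_arrows n) = 0%N).
  rewrite -count_cat -qarr_En -(card_nth_eq (0, 0)%N); by apply: eq_card => a; rewrite !inE.
by apply/count_memPn/negP=> /tree_arrowsP[] []; lia.
Qed.

End EnQuiver.

Theorem theorem5p3 (K : closedFieldType) (n : nat) (N : 'I_n -> nat) :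
  (6 <= n <= 8)%N ->
  fpd_is K (En_quiver N) ((\max_(i < n) N i)%:R).
Proof.
move=> /andP[n6 _]; have n4 : (4 <= n)%N by lia.
have [st stE] := En_endpoints N n4; set Q := En_quiver N in st stE *.
pose src a := (st a).1; pose tgt a := (st a).2.
have srcE a : qsrc a = (src a).+1 := (stE a).1.
have tgtE a : qtgt a = (tgt a).+1 := (stE a).2.
have nlE a : (src a != tgt a) = (qsrc a != qtgt a) by rewrite srcE tgtE.
have parent_uniq a b : src a != tgt a -> src b != tgt b -> tgt a = tgt b -> a = b.
  by rewrite !nlE => a_nl b_nl ab; apply: En_parent_uniq; rewrite // !tgtE ab.
have outdeg_le2 a b c : src a != tgt a -> src b != tgt b -> src c != tgt c ->
    src a = src b -> src b = src c -> [|| a == b, b == c | a == c].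
  by rewrite !nlE => a_nl b_nl c_nl ab bc; apply: En_outdeg_le2; rewrite // !srcE ?ab ?bc.
pose depth (i : 'I_n) := tree_depth i.+1.
have depthS a : src a != tgt a -> depth (tgt a) = (depth (src a)).+1.
  by rewrite nlE /depth -tgtE -srcE; apply: En_depth.
have card_loops i : #|[set a | (src a == i) && (tgt a == i)]| = N i.
  by rewrite -En_card_loops; apply: eq_card => a; rewrite !inE srcE tgtE !eqSS.
split=> [m B [B_gt0 B_hom] | eps eps_gt0].
  have B_brick p : brick (B p) by split=> //; rewrite B_hom eqxx.
  have [top topP] : exists top : 'I_m -> 'I_n, forall p, brick_top src tgt (B p) (top p).
    suff : forall p, exists i, brick_top src tgt (B p) i by move/fin_all_exists.
    by move=> p; apply: (brick_has_top srcE tgtE parent_uniq outdeg_le2).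
  apply: spectral_radius_le => // z.
  (* Ordering the bricks by the depth of their tops makes the adjacency matrix triangular, so every
     eigenvalue is a diagonal entry. *)
  case/(eigenvalue_height_triangular (h := fun p => depth (top p))) => [p q pq | q ->].
    rewrite mxE; apply: contraNltn => qp; apply/eqP; rewrite [dim_ext _ _](_ : _ = 0%N) //.
    apply: (ext_orthogonal_bricks srcE tgtE parent_uniq outdeg_le2 depthS _ _
              (topP p) (topP q)) => //.
      by rewrite B_hom (negPf pq).
    by rewrite B_hom eq_sym (negPf pq).
  rewrite mxE normr_nat ler_nat.
  have [/existsP[a xa] | /existsPn x0] := boolP [exists a, marr (B q) a != 0].
    by rewrite (ext_nonsimple_brick srcE tgtE parent_uniq (topP q) xa).
  rewrite (ext_simple_brick srcE tgtE (B_brick q) (topP q)) ?card_loops ?leq_bigmax // => a.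
  by apply/eqP; rewrite -[_ == _]negbK x0.
(* The simple module at a vertex with most loops is by itself a brick set attaining the bound, for
   every [eps]. *)
have [|i0 maxN] := @bigop.eq_bigmax 'I_n N; first by rewrite card_ord; lia.
exists 1%N, (fun _ => simple_Emod K (i0 : 'I_(qv Q))); split.
  by split=> [//|p q]; rewrite dim_hom_simple !ord1 eqxx.
rewrite spectral_radius_mx11 mxE ?ler0n //.
rewrite (dim_ext_simple srcE tgtE (i := i0)) // card_loops maxN.
by rewrite ltrBlDr ltrDl.
Qed.
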